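(* Let $n\ge 1$, let $A\in\mathcal{M}(n;\mathbb{C})$ have characteristic polynomial $$p_A(\lambda)=\lambda^n+a_{n-1}\lambda^{n-1}+\cdots+a_1\lambda+a_0,$$ let $\tau\in\mathbb{R}$, $X_0\in\mathcal{M}(n\times 1;\mathbb{C})$, and let $F:\mathbb{R}\times\mathcal{M}(n\times 1;\mathbb{C})\to\mathcal{M}(n\times 1;\mathbb{C})$ be continuously differentiable and, moreover, of class $C^{n-1}$. Let $X\in C^1(\mathbb{R};\mathcal{M}(n\times 1;\mathbb{C}))$ be the (unique, for $t\ge\tau$) solution of $$X'(t)=AX(t)+F(t,X(t)),\quad t>\tau,\qquad X(\tau)=X_0 .$$ Then $X$ satisfies, for $t>\tau$, $$X^{(n)}+a_{n-1}X^{(n-1)}+\cdots+a_1X'+a_0X-\sum_{j=0}^{n-2}p_{j,A}(A)\,\partial_t^{(n-j-1)}F(t,X)=p_{n-1,A}(A)\,F(t,X),$$ together with $X(\tau)=X_0$.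
   Context: $\mathcal{M}(k\times\ell;\mathbb{C})$ is the set of complex matrices with $k$ rows and $\ell$ columns, and $\mathcal{M}(k;\mathbb{C})=\mathcal{M}(k\times k;\mathbb{C})$. The characteristic polynomial of $A$ is the monic polynomial $p_A(\lambda)=\det(\lambda I-A)$; put $a_n=1$. For $0\le j\le n$ define $$p_{j,A}(\lambda)=\lambda^j+a_{n-1}\lambda^{j-1}+\cdots+a_{n-j+1}\lambda+a_{n-j},$$ so $p_{0,A}=1$ and $p_{n,A}=p_A$; $p_{j,A}(A)$ is this polynomial evaluated at the matrix $A$. The notation $\partial_t^{(k)}F(t,X)$ means the $k$-th (total) derivative with respect to $t$ of the function $t\mapsto F(t,X(t))$, with $\partial_t^{(0)}F(t,X)=F(t,X(t))$; also $X^{(k)}$ is the $k$-th derivative of $X$ and $X^{(0)}=X$. Smoothness of $F$ is in the real sense, identifying $\mathcal{M}(n\times 1;\mathbb{C})$ with $\mathbb{R}^{2n}$. An empty sum is $0$. *)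

(* Defs.v *)
From HB Require Import structures.
From mathcomp Require Import all_boot all_order all_algebra.
From mathcomp Require Import complex.
From mathcomp Require Import all_classical all_reals all_analysis.

Set Implicit Arguments.
Unset Strict Implicit.
Unset Printing Implicit Defensive.

Import Order.TTheory GRing.Theory Num.Theory.
Import numFieldNormedType.Exports.

Local Open Scope classical_set_scope.
Local Open Scope ring_scope.
Local Open Scope complex_scope.

(* An alias is needed for the REAL normed space structure: on 'cV[R[i]]_n itself
   the canonical module structure is the one over the scalars R[i], whereas the
   derivatives and the smoothness below are taken over R, i.e. with
   M(n x 1; C) seen as R^(2n) (all norms there being equivalent). *)
Definition cvec (R : realType) (n : nat) := 'cV[R[i]]_n.

Section RealNormedSpace.
Context {R : realType} {n : nat}.

HB.instance Definition _ := GRing.Zmodule.on (cvec R n).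

Definition cvec_scale (a : R) (v : cvec R n) : cvec R n :=
  a%:C *: (v : 'cV[R[i]]_n).

Fact cvec_scaleA (a b : R) (v : cvec R n) :
  cvec_scale a (cvec_scale b v) = cvec_scale (a * b) v.
Proof. by rewrite /cvec_scale scalerA -rmorphM. Qed.

Fact cvec_scale1 : left_id 1 cvec_scale.
Proof. by move=> v; rewrite /cvec_scale rmorph1 scale1r. Qed.

Fact cvec_scaleDr : right_distributive cvec_scale +%R.
Proof. by move=> a u v; exact: (@scalerDr _ 'cV[R[i]]_n). Qed.

Fact cvec_scaleDl (v : cvec R n) :
  {morph cvec_scale^~ v : a b / a + b}.
Proof. by move=> a b; rewrite /cvec_scale rmorphD; exact: (@scalerDl _ 'cV[R[i]]_n). Qed.

HB.instance Definition _ := GRing.Zmodule_isLmodule.Build R (cvec R n)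
  cvec_scaleA cvec_scale1 cvec_scaleDr cvec_scaleDl.

(* Normc.normc is the R-valued modulus. *)
Definition cvec_norm (v : cvec R n) : R :=
  \big[Num.max/0]_(i < n) Normc.normc ((v : 'cV[R[i]]_n) i ord0).

Let normc_ge0 (z : R[i]) : 0 <= Normc.normc z.
Proof. by case: z => a b; exact: sqrtr_ge0. Qed.

Fact cvec_normD (u v : cvec R n) :
  cvec_norm (u + v) <= cvec_norm u + cvec_norm v.
Proof.
apply: bigmax_le => [|i _].
  by rewrite addr_ge0 // /cvec_norm bigmax_idl le_max lexx.
rewrite mxE; apply: le_trans (le_normcD _ _) _.
by apply: lerD; apply: (@le_bigmax_cond _ _ _ _ _ _ (fun i => Normc.normc _)).
Qed.

Fact cvec_normZ (a : R) (v : cvec R n) :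
  cvec_norm (a *: v) = `|a| * cvec_norm v.
Proof.
rewrite /cvec_norm; elim/big_ind2 : _ => [|x1 x2 y1 y2 -> ->|i _].
- by rewrite mulr0.
- by rewrite maxr_pMr.
- rewrite mxE Normc.normcM; congr (_ * _).
  by rewrite /= expr0n /= addr0 sqrtr_sqr.
Qed.

Fact cvec_norm_eq0 (v : cvec R n) : cvec_norm v = 0 -> v = 0.
Proof.
move=> v0; apply/colP => i; rewrite mxE; apply: Normc.eq0_normc.
apply/eqP; rewrite eq_le normc_ge0 andbT -v0.
by apply: (@le_bigmax_cond _ _ _ _ _ _ (fun i => Normc.normc _)).
Qed.

HB.instance Definition _ := Lmodule_isNormed.Build R (cvec R n)
  cvec_normD cvec_normZ cvec_norm_eq0.

End RealNormedSpace.

(* f is of class C^k on V; for finite-dimensional V, the continuity of the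
   differential x |-> 'd f x (and of its own differentials) amounts to that of
   x |-> 'd f x v for each direction v. *)
Fixpoint class_C {R : realType} {V W : normedModType R} (k : nat) (f : V -> W) : Prop :=
  match k with
  | 0 => continuous f
  | k'.+1 => (forall x, differentiable f x) /\ (forall v, class_C k' ('D_v f))
  end.

(* p_{j,A}, for 0 <= j <= n *)
Definition pjA {F : comNzRingType} {n : nat} (A : 'M[F]_n) (j : nat) : {poly F} :=
  'X^j + \poly_(i < j) (char_poly A)`_(n - j + i).

(* Main.v *)
(* On t > tau, the equation bootstraps the regularity of X: if X is C^k with
   k <= n - 1 then, by the chain rule, so is t |-> F (t, X t), hence X' is C^k
   and X is C^(k+1).  Therefore X^(k+1) = A X^(k) + (F (t, X))^(k) for k < n.
   Any sequence with x_(k+1) = A x_k + f_k satisfies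
     \sum_(l <= j) a_(n-j+l) x_l = p_j(A) x_0 + \sum_(i < j) p_i(A) f_(j-1-i),
   and for j = n the first term on the right vanishes by Cayley-Hamilton. *)
Require Import Defs.
From HB Require Import structures.
From mathcomp Require Import all_boot all_order all_algebra.
From mathcomp Require Import zify complex.
From mathcomp Require Import all_classical all_reals all_analysis.

Set Implicit Arguments.
Unset Strict Implicit.
Unset Printing Implicit Defensive.

Import Order.TTheory GRing.Theory Num.Theory.
Import numFieldNormedType.Exports.

Local Open Scope ring_scope.

(** * Functions of class C^k on the open half-line t > tau *)

(** The equation is given only for t > tau, so higher regularity is recorded there, with the same
    [derive1] that the conclusion iterates. *)
Fixpoint class_C_after {R : realType} {W : normedModType R} (tau : R) (k : nat)
    (g : R -> W) : Prop :=
  match k with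
  | 0 => forall t, tau < t -> {for t, continuous g}
  | k'.+1 => (forall t, tau < t -> derivable g t 1) /\
             class_C_after tau k' (derive1 g)
  end.

Section ClassCAfter.
Local Open Scope classical_set_scope.
Context {R : realType} (tau : R).
Implicit Types V W : normedModType R.

Lemma near_after (t : R) : tau < t -> \forall s \near t, tau < s.
Proof. exact: lt_nbhsr. Qed.

Lemma eq_after_derive1 W (f g : R -> W) :
  (forall t, tau < t -> f t = g t) ->
  forall t, tau < t -> derive1 f t = derive1 g t.
Proof.
move=> fg t taut; rewrite !derive1E; apply: near_eq_derive.
by near=> s; apply: fg; near: s; exact: near_after.
Unshelve. all: by end_near. Qed.

(** The half-line is open, so it is a neighbourhood of each of its points. In the inductions below
    this replaces a derivative by a formula valid only after tau. *)
Lemma eq_class_C_after W k (f g : R -> W) :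
  (forall t, tau < t -> f t = g t) ->
  class_C_after tau k f -> class_C_after tau k g.
Proof.
elim: k f g => [|k IHk] f g fg /=.
  move=> fC t taut; rewrite /prop_for /continuous_at -fg //.
  apply: cvg_trans (fC t taut); apply: near_eq_cvg.
  by near=> s; apply: fg; near: s; exact: near_after.
move=> [fD fC]; split=> [t taut|]; last first.
  by apply: IHk fC; exact: eq_after_derive1.
move: (fD t taut); apply: near_eq_derivable.
by near=> s; apply: fg; near: s; exact: near_after.
Unshelve. all: by end_near. Qed.

Lemma class_C_after_pred W k (g : R -> W) :
  class_C_after tau k.+1 g -> class_C_after tau k g.
Proof.
elim: k g => [|k IHk] g [gD gC]; last by split=> //; exact: IHk.
move=> t taut; apply: differentiable_continuous.
by apply/derivable1_diffP; exact: gD.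
Qed.

Lemma class_C_after_derivable W k l (g : R -> W) t :
  class_C_after tau k g -> (l < k)%N -> tau < t -> derivable (derive1n l g) t 1.
Proof.
elim: k l g => [|k IHk] [|l] g // [gD gC] lk taut; first exact: gD.
by rewrite derive1Sn; exact: IHk.
Qed.

Lemma class_C_after_cst W k (a : W) : class_C_after tau k (cst a).
Proof.
elim: k a => [|k IHk] a; first by move=> t _; exact: cst_continuous.
split=> [t _|]; first exact: derivable_cst.
by apply: (eq_class_C_after _ (IHk 0)) => t _; rewrite derive1_cst.
Qed.

Lemma class_C_after_id k : class_C_after tau k (id : R -> R).
Proof.
case: k => [|k]; first by move=> t _; exact: cvg_id.
split=> [t _|]; first exact: derivable_id.
apply: (eq_class_C_after _ (class_C_after_cst k (1 : R))) => t _.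
by rewrite derive1_id.
Qed.

Lemma derive1D W (f g : R -> W) t :
  derivable f t 1 -> derivable g t 1 ->
  derive1 (fun s => f s + g s) t = derive1 f t + derive1 g t.
Proof. by move=> fD gD; rewrite !derive1E; exact: deriveD. Qed.

Lemma class_C_afterD W k (f g : R -> W) :
  class_C_after tau k f -> class_C_after tau k g ->
  class_C_after tau k (fun t => f t + g t).
Proof.
elim: k f g => [|k IHk] f g /=.
  by move=> fC gC t taut; apply: cvgD; [exact: fC|exact: gC].
move=> [fD fC] [gD gC]; split=> [t taut|].
  by apply: derivableD; [exact: fD|exact: gD].
apply: (eq_class_C_after _ (IHk _ _ fC gC)) => t taut.
by rewrite derive1D //; [exact: fD|exact: gD].
Qed.

Lemma class_C_after_sum W k (I : finType) (f : I -> R -> W) :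
  (forall i, class_C_after tau k (f i)) ->
  class_C_after tau k (fun t => \sum_i f i t).
Proof.
move=> fC; elim: (index_enum I) => [|i s IHs].
  by apply: (eq_class_C_after _ (class_C_after_cst k 0)) => t _; rewrite big_nil.
apply: (eq_class_C_after _ (class_C_afterD (fC i) IHs)) => t _.
by rewrite big_cons.
Qed.

Lemma derive1_linear V W (L : {linear V -> W}) (g : R -> V) t :
  continuous L -> derivable g t 1 ->
  derivable (L \o g) t 1 /\ derive1 (L \o g) t = L (derive1 g t).
Proof.
move=> LC /derivable1_diffP gD.
have LgD : differentiable (L \o g) t.
  by apply: differentiable_comp => //; exact: linear_differentiable.
split; first exact/derivable1_diffP.
rewrite !derive1E' // diff_comp //; last exact: linear_differentiable.
by rewrite /= diff_lin.
Qed.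

Lemma class_C_after_linear V W k (L : {linear V -> W}) (g : R -> V) :
  continuous L -> class_C_after tau k g -> class_C_after tau k (L \o g).
Proof.
move=> LC; elim: k g => [|k IHk] g /=.
  by move=> gC t taut; apply: continuous_comp; [exact: gC|exact: LC].
move=> [gD gC]; split=> [t taut|]; first by have [] := derive1_linear LC (gD t taut).
apply: (eq_class_C_after _ (IHk _ gC)) => t taut.
by have [_ ->] := derive1_linear LC (gD t taut).
Qed.

Lemma derive1_scale W (f : R -> R) (g : R -> W) t :
  derivable f t 1 -> derivable g t 1 ->
  derivable (fun s => f s *: g s) t 1 /\
  derive1 (fun s => f s *: g s) t = derive1 f t *: g t + f t *: derive1 g t.
Proof.
move=> fD gD.
suff H : (h^-1 *: (f (h *: 1 + t) *: g (h *: 1 + t) - f t *: g t)) @[h --> 0^']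
    --> derive1 f t *: g t + f t *: derive1 g t.
  split; first by apply/cvg_ex; eexists; exact: H.
  by rewrite derive1E; exact: (cvg_lim (@norm_hausdorff _ _) H).
(* Splitting of the product rule: the increment of f times g(t), plus f(t+h) times the increment of
   g. *)
have E : (fun h => (h^-1 *: (f (h *: 1 + t) - f t)) *: g t
      + f (h *: 1 + t) *: (h^-1 *: (g (h *: 1 + t) - g t)))
    = (fun h => h^-1 *: (f (h *: 1 + t) *: g (h *: 1 + t) - f t *: g t)).
  apply/funext => h.
  by rewrite !scalerBr scalerBl !scalerA [_ * h^-1]mulrC addrC subrKA.
rewrite -E !derive1E; apply: cvgD; first exact: cvgZr_tmp.
apply: cvgZ; last exact: gD.
suff : {for 0, continuous (fun h : R => f (h *: 1 + t))}.
  by move=> /continuous_withinNx; rewrite scale0r add0r.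
exact/differentiable_continuous/derivable1_diffP/(derivable1P _ _ _).1.
Qed.

Lemma class_C_after_scale W k (f : R -> R) (g : R -> W) :
  class_C_after tau k f -> class_C_after tau k g ->
  class_C_after tau k (fun t => f t *: g t).
Proof.
elim: k f g => [|k IHk] f g /=.
  by move=> fC gC t taut; apply: cvgZ; [exact: fC|exact: gC].
move=> [fD fC] [gD gC]; split=> [t taut|].
  by have [] := derive1_scale (fD t taut) (gD t taut).
(* In f' g + f g' the derivatives are known to be C^k only, so f and g are lowered to C^k before the
   induction hypothesis applies. *)
have fCk : class_C_after tau k f by apply: class_C_after_pred; split.
have gCk : class_C_after tau k g by apply: class_C_after_pred; split.
apply: (eq_class_C_after _ (class_C_afterD (IHk _ _ fC gCk) (IHk _ _ fCk gC))).
by move=> t taut; have [_ ->] := derive1_scale (fD t taut) (gD t taut).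
Qed.

Lemma class_C_after_pair V W k (f : R -> V) (g : R -> W) :
  class_C_after tau k f -> class_C_after tau k g ->
  class_C_after tau k (fun t => (f t, g t)).
Proof.
elim: k f g => [|k IHk] f g /=.
  by move=> fC gC t taut; apply: cvg_pair; [exact: fC|exact: gC].
move=> [fD fC] [gD gC].
have df t : tau < t -> differentiable f t.
  by move=> taut; apply/derivable1_diffP; exact: fD.
have dg t : tau < t -> differentiable g t.
  by move=> taut; apply/derivable1_diffP; exact: gD.
split=> [t taut|].
  by apply/derivable1_diffP; apply: differentiable_pair; [exact: df|exact: dg].
apply: (eq_class_C_after _ (IHk _ _ fC gC)) => t taut.
have dft := df t taut; have dgt := dg t taut.
by rewrite !derive1E' ?diff_pair //; exact: differentiable_pair.
Qed.

End ClassCAfter.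

(** * Continuity and the chain rule through finitely many continuous coordinates *)

Section Frame.
Context {R : realType} {V : normedModType R} {I : finType}.
Variables (e : I -> V) (c : I -> {linear V -> R}).
Hypothesis cC : forall i, continuous (c i).
Hypothesis ce : forall v, v = \sum_i c i v *: e i.

(** L v is the finite sum of the c_i(v) L(e_i): continuous scalars times fixed vectors. *)
Lemma frame_linear_continuous (W : normedModType R) (L : {linear V -> W}) :
  continuous L.
Proof.
have -> : (L : V -> W) = (fun v => \sum_i c i v *: L (e i)).
  apply/funext => v; rewrite {1}[v]ce linear_sum.
  by apply: eq_bigr => i _; rewrite linearZ.
move=> v; apply: cvg_big => [|i _]; first exact: add_continuous.
by apply: cvgZr_tmp; exact: cC.
Qed.

(* [class_C] only speaks of directional derivatives along fixed vectors; expanding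
   g' in the frame writes ('d f (g t)) (g' t) as a combination of those. *)
Lemma class_C_after_comp tau (W : normedModType R) k (f : V -> W) (g : R -> V) :
  class_C k f -> class_C_after tau k g -> class_C_after tau k (f \o g).
Proof.
elim: k f g => [|k IHk] f g /=.
  by move=> fC gC t taut; apply: continuous_comp; [exact: gC|exact: fC].
move=> [fD fC] [gD gC].
have dg t : tau < t -> differentiable g t.
  by move=> taut; apply/derivable1_diffP; exact: gD.
have gCk : class_C_after tau k g by apply: class_C_after_pred; split.
split=> [t taut|].
  by apply/derivable1_diffP/differentiable_comp; [exact: dg|exact: fD].
have H : class_C_after tau k
    (fun t => \sum_i c i (derive1 g t) *: derive f (g t) (e i)).
  apply: class_C_after_sum => i; apply: class_C_after_scale.
    exact: (class_C_after_linear (@cC i) gC).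
  exact: (IHk _ _ (fC (e i)) gCk).
apply: (eq_class_C_after _ H) => t taut.
have dgt := dg t taut; have dft := fD (g t).
have -> : derive1 (f \o g) t = 'd f (g t) ('d g t 1).
  by rewrite derive1E'; [rewrite (diff_comp dgt dft)|exact: differentiable_comp].
(* Only the argument of ['d f (g t)] is expanded; the copy of g' inside the coordinates stays. *)
rewrite (derive1E' dgt) {2}(ce ('d g t 1)) linear_sum.
by apply: eq_bigr => i _; rewrite linearZ deriveE.
Qed.

End Frame.

(** * Real coordinates on C^n and on R x C^n *)

Section CvecFrame.
Context {R : realType} {n : nat}.
Implicit Types (v : cvec R n) (p : 'I_n * bool).

Definition cvec_coord p v : R :=
  let z := (v : 'cV[R[i]]_n) p.1 ord0 in
  if p.2 then complex.Im z else complex.Re z.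

(** The scaling is the complex one: row k contributes the unit vector e_k and its multiple by the
    imaginary unit, which gives a basis of R^(2n). *)
Definition cvec_basis p : cvec R n :=
  (if p.2 then (0 +i* 1)%C else 1) *: (delta_mx p.1 ord0 : 'cV[R[i]]_n).

Fact cvec_coord_is_linear p : linear (cvec_coord p).
Proof.
move=> a u v; rewrite /cvec_coord !mxE /=.
case: (_ p.1 ord0) => a1 b1; case: (v _ _) => a2 b2 /=.
by case: p.2; rewrite /= !mul0r ?subr0 ?addr0.
Qed.

HB.instance Definition _ p :=
  GRing.isLinear.Build R (cvec R n) R *:%R (cvec_coord p) (cvec_coord_is_linear p).

Lemma cvec_coord_le_norm p v : `|cvec_coord p v| <= `|v|.
Proof.
have le_normc : Normc.normc ((v : 'cV[R[i]]_n) p.1 ord0) <= `|v|.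
  rewrite -[`|v|]/(cvec_norm v) /cvec_norm.
  by apply: (@le_bigmax_cond _ _ _ _ _ _ (fun i => Normc.normc (_ i ord0))).
apply: le_trans le_normc; rewrite /cvec_coord.
case: (_ p.1 ord0) => a b /=.
by case: p.2; rewrite -sqrtr_sqr ler_sqrt ?lerDl ?lerDr ?addr_ge0 ?sqr_ge0.
Qed.

Lemma cvec_coord_continuous p : continuous (cvec_coord p).
Proof.
apply: bounded_linear_continuous; apply/linear_boundedP.
(* Boundedness is asked for all large constants r; every r > 1 works. *)
exists 1; split=> // r r1 v; apply: le_trans (cvec_coord_le_norm p v) _.
by rewrite ler_peMl // ltW.
Qed.

Lemma cvec_coord_sum v : v = \sum_p cvec_coord p v *: cvec_basis p.
Proof.
rewrite -(pair_bigA _ (fun i b => cvec_coord (i, b) v *: cvec_basis (i, b))) /=.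
under eq_bigr do rewrite big_bool.
apply/colP => i; rewrite (summxE _ _ (fun j => _ : 'cV[R[i]]_n)).
rewrite (bigD1 i) //= big1 ?addr0 => [|j ji]; rewrite !mxE /= ?eqxx; last first.
  by rewrite eq_sym (negPf ji) !mulr0 addr0.
rewrite /cvec_coord /=; case: (v i ord0) => a b.
apply/eqP; rewrite eq_complex /= !mulr0 !mul0r !mulr1 !subr0 !add0r !addr0.
by rewrite !mulr0 !mulr1 add0r addr0 !eqxx.
Qed.

(** [F] is defined on R x C^n, so the chain rule for F(t, X(t)) needs coordinates there; [inl tt] is
    the time coordinate. *)
Definition time_cvec_coord (o : unit + 'I_n * bool) (w : R * cvec R n) : R :=
  if o is inr p then cvec_coord p w.2 else w.1.

Definition time_cvec_basis (o : unit + 'I_n * bool) : R * cvec R n :=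
  if o is inr p then (0, cvec_basis p) else (1, 0).

Fact time_cvec_coord_is_linear o : linear (time_cvec_coord o).
Proof. by case: o => [[]|p] a u v //=; rewrite linearP. Qed.

HB.instance Definition _ o :=
  GRing.isLinear.Build R (R * cvec R n)%type R *:%R (time_cvec_coord o)
    (time_cvec_coord_is_linear o).

Lemma time_cvec_coord_continuous o : continuous (time_cvec_coord o).
Proof.
case: o => [[]|p] w /=; first exact: cvg_fst.
by apply: continuous_comp; [exact: cvg_snd|exact: cvec_coord_continuous].
Qed.

Lemma time_cvec_coord_sum w :
  w = \sum_o time_cvec_coord o w *: time_cvec_basis o.
Proof.
(* The map v to (0, v) is real-linear, so the sum over the vector coordinates can be taken inside
   the pair. *)
have inr0D (v1 v2 : cvec R n) : (0, v1 + v2) = (0, v1) + (0, v2) :> R * cvec R n.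
  by rewrite -[RHS]/(0 + 0, _) addr0.
have inr0Z (a : R) (v : cvec R n) : (0, a *: v) = a *: (0, v) :> R * cvec R n.
  by rewrite -[RHS]/(a *: 0, _) scaler0.
rewrite big_sumType (big_pred1 tt) /=; last by case.
under eq_bigr do rewrite -inr0Z.
rewrite -(big_morph (fun v : cvec R n => (0, v) : R * cvec R n) inr0D (erefl _)).
rewrite -cvec_coord_sum; case: w => s v /=.
by rewrite -[RHS]/(s *: 1 + 0, s *: 0 + v) scaler0 add0r addr0 /GRing.scale /= mulr1.
Qed.

End CvecFrame.

(** * Truncated characteristic polynomials and the recurrence they solve *)

Section TruncatedCharPoly.
Context {K : comNzRingType} {m : nat}.
Local Notation n := m.+1.
Variable A : 'M[K]_n.

Lemma pjA0 : pjA A 0 = 1.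
Proof. by rewrite /pjA expr0 poly_def big_ord0 addr0. Qed.

(** One step of Horner's scheme for the characteristic polynomial. *)
Lemma pjAS j : (j < n)%N ->
  pjA A j.+1 = pjA A j * 'X + ((char_poly A)`_(n - j.+1))%:P.
Proof.
move=> jn; apply/polyP => i; rewrite /pjA !coefD coefMX coefC !coefD !coefXn !coef_poly.
case: i => [|i] /=; first by rewrite !add0r addn0.
(* The indices agree because j < n keeps the natural subtraction exact. *)
by rewrite addr0 eqSS ltnS; case: ifP => // ij; congr (_ + _`_ _); lia.
Qed.

Lemma horner_mx_pjAS j : (j < n)%N ->
  horner_mx A (pjA A j.+1)
    = horner_mx A (pjA A j) *m A + ((char_poly A)`_(n - j.+1))%:M.
Proof.
move=> jn; rewrite (pjAS jn) (rmorphD (horner_mx A) (_ * _)) rmorphM /=.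
by rewrite horner_mx_X horner_mx_C.
Qed.

Lemma char_poly_coef_dim : (char_poly A)`_n = 1.
Proof.
by have /monicP := char_poly_monic A; rewrite lead_coefE size_char_poly.
Qed.

Lemma pjA_dim : pjA A n = char_poly A.
Proof.
apply/polyP => i; rewrite /pjA coefD coefXn coef_poly subnn add0n.
case: ltngtP => [lt_in|lt_ni|->]; rewrite ?add0r ?addr0 ?char_poly_coef_dim //.
by rewrite nth_default // size_char_poly.
Qed.

(** The algebraic core: [x] and [f] will be the derivatives of X and of F(t, X) at one fixed
    time. *)
Lemma char_poly_recurrence (x f : nat -> 'cV[K]_n) :
  (forall k, (k < n)%N -> x k.+1 = A *m x k + f k) ->
  x n + \sum_(k < n) (char_poly A)`_k *: x k
    = \sum_(j < n) horner_mx A (pjA A j) *m f (n - j - 1)%N.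
Proof.
move=> xS.
(* Induction on j, for all shifts s at once: the step applies the hypothesis at
   s.+1 and uses p_{j+1} = p_j 'X + a_{n-j-1}. *)
have H j s : (s + j <= n)%N ->
    \sum_(l < j.+1) (char_poly A)`_(n - j + l) *: x (s + l)%N
    = horner_mx A (pjA A j) *m x s
      + \sum_(i < j) horner_mx A (pjA A i) *m f (s + (j - i - 1))%N.
  elim: j s => [|j IHj] s sj.
    rewrite big_ord0 big_ord1 pjA0 rmorph1 mul1mx addr0 subn0 !addn0.
    by rewrite char_poly_coef_dim scale1r.
  (* The term l = 0 is a_(n-j-1) x_s; the others form the sum for j at the shift s+1. *)
  rewrite big_ord_recl /= !addn0.
  under eq_bigr => l _.
    have -> : (n - j.+1 + bump 0 l = n - j + l)%N by rewrite /bump; lia.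
    have -> : (s + bump 0 l = s.+1 + l)%N by rewrite /bump; lia.
    over.
  rewrite IHj; last by lia.
  rewrite xS; last by lia.
  rewrite horner_mx_pjAS; last by lia.
  rewrite mulmxDl mulmxDr mul_scalar_mx !mulmxA.
  (* The last summand, i = j, is p_j(A) f_s, which is what x_(s+1) = A x_s + f_s contributes. *)
  rewrite big_ord_recr /= subSnn subnn addn0.
  have -> : \sum_(i < j) horner_mx A (pjA A i) *m f (s.+1 + (j - i - 1))%N
      = \sum_(i < j) horner_mx A (pjA A i) *m f (s + (j.+1 - i - 1))%N.
    apply: eq_bigr => i _; congr (_ *m f _).
    by have := ltn_ord i; lia.
  by rewrite [X in _ = X + _]addrC -!addrA; congr (_ + (_ + _)); exact: addrC.
have := H n 0%N (leqnn _).
rewrite pjA_dim Cayley_Hamilton mul0mx add0r subnn.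
rewrite big_ord_recr /= addrC => <-.
by rewrite !add0n char_poly_coef_dim scale1r; congr (_ + _).
Qed.

End TruncatedCharPoly.

Lemma class_C_le (R : realType) (V W : normedModType R) k l (f : V -> W) :
  (k <= l)%N -> class_C l f -> class_C k f.
Proof.
elim: k l f => [|k IHk] [|l] f //=.
  by move=> _ [fD _] x; exact: differentiable_continuous.
by move=> kl [fD fC]; split=> // v; exact: IHk (fC v).
Qed.

(** * Multiplication by A as a continuous real-linear map *)

Section CvecMulmx.
Context {R : realType} {n : nat}.
Variable A : 'M[R[i]]_n.

Definition cvec_mulmx (v : cvec R n) : cvec R n := A *m v.

Fact cvec_mulmx_is_linear : linear cvec_mulmx.
Proof.
by move=> a u v; rewrite /cvec_mulmx mulmxDr; congr (_ + _); exact/esym/scalemxAr.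
Qed.

HB.instance Definition _ :=
  GRing.isLinear.Build R (cvec R n) (cvec R n) *:%R cvec_mulmx cvec_mulmx_is_linear.

Lemma cvec_mulmx_continuous : continuous cvec_mulmx.
Proof.
exact: (frame_linear_continuous cvec_coord_continuous cvec_coord_sum).
Qed.

End CvecMulmx.

(* The dimension is n := m.+1, i.e. n >= 1. *)
Theorem theorem2p2 (R : realType) (m : nat) :
  let n := m.+1 in
  forall (A : 'M[R[i]]_n) (tau : R) (X0 : cvec R n)
    (F : R * cvec R n -> cvec R n) (X : R -> cvec R n),
  class_C 1 F -> class_C n.-1 F ->
  class_C 1 X ->
  (forall t, tau < t -> derive1 X t = A *m X t + F (t, X t)) ->
  X tau = X0 ->
  let FX := fun t => F (t, X t) in
  [/\ (forall k t, (k < n)%N -> tau < t -> derivable (derive1n k X) t 1),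
      (forall k t, (k < n.-1)%N -> tau < t -> derivable (derive1n k FX) t 1),
      (forall t, tau < t ->
        (derive1n n X t : 'cV[R[i]]_n)
          + \sum_(k < n) (char_poly A)`_k *: (derive1n k X t : 'cV[R[i]]_n)
          - \sum_(j < n.-1) horner_mx A (pjA A j) *m derive1n (n - j - 1) FX t
        = horner_mx A (pjA A n.-1) *m FX t)
    & X tau = X0].
Proof.
move=> n A tau X0 F X _ FC [dX _] X'E XtauE FX.
have dX1 t : derivable X t 1 by apply/derivable1_diffP; exact: dX.
have FXC k : (k <= m)%N -> class_C_after tau k X -> class_C_after tau k FX.
  move=> km XCk.
  have FCk : class_C k F by exact: class_C_le km FC.
  apply: (class_C_after_comp time_cvec_coord_continuous time_cvec_coord_sum FCk).
  exact: class_C_after_pair (class_C_after_id tau k) XCk.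
(* Bootstrap: A X + F(t, X) is C^k once X is, and it equals X'. Since [FXC] needs k <= n-1, the gain
   stops at X of class C^n. *)
have XC k : (k <= n)%N -> class_C_after tau k X.
  elim: k => [_ t _|k IHk kn]; first exact: differentiable_continuous.
  have XCk := IHk (ltnW kn); split=> [t _ //|].
  apply: (@eq_class_C_after _ _ _ _ (fun t => cvec_mulmx A (X t) + FX t)).
    by move=> t /X'E ->.
  apply: class_C_afterD; last exact: FXC.
  exact: (class_C_after_linear (@cvec_mulmx_continuous _ _ A) XCk).
have XCn := XC n (leqnn _); have FXCm := FXC m (leqnn _) (XC m (leqnSn _)).
have dXk k t : (k < n)%N -> tau < t -> derivable (derive1n k X) t 1.
  exact: class_C_after_derivable.
have dFXk k t : (k < m)%N -> tau < t -> derivable (derive1n k FX) t 1.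
  exact: class_C_after_derivable.
(* The time is quantified after k because the step differentiates the hypothesis, an identity on the
   whole half-line. *)
have XS k : (k < n)%N -> forall t, tau < t ->
    derive1n k.+1 X t = cvec_mulmx A (derive1n k X t) + derive1n k FX t.
  elim: k => [_ t|k IHk kn t taut]; first exact: X'E.
  rewrite [LHS](eq_after_derive1 (IHk (ltnW kn))) //.
  have [dL LE] :=
    derive1_linear (@cvec_mulmx_continuous _ _ A) (dXk _ _ (ltnW kn) taut).
  (* Here k+1 < n is the same as k < m, the range where F(t, X) is known to be differentiable k+1
     times. *)
  have dFt := dFXk k t kn taut.
  apply: etrans (derive1D dL dFt) _.
  by congr (_ + _).
split=> // t taut.
pose x k : 'cV[R[i]]_n := derive1n k X t.
pose f k : 'cV[R[i]]_n := derive1n k FX t.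
have xS k : (k < n)%N -> x k.+1 = A *m x k + f k by move=> kn; exact: XS.
(* The summand j = n-1 is p_(n-1)(A) f_0, the right-hand side; the remaining ones cancel the
   subtracted sum. *)
rewrite [X in X - _](char_poly_recurrence xS) big_ord_recr /= subSnn subnn.
by rewrite addrAC subrr add0r.
Qed.
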